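(* For every integer $l\ge 3$ there is a constant $c_l>0$, depending on $l$ but not on $d$ and $k$, such that for all integers $d\ge 2$ and $k\ge 1$, \[ d\left\lfloor\frac{k}{c_l\,d^{\frac{2}{l+1}}\log d}\right\rfloor<R_d(k,l)< 2d^{\,l-2}k . \]
   Context: $\log$ denotes the base 2 logarithm. A subcube of $\{0,1\}^d$ is a (non-empty) set of points of $\{0,1\}^d$ obtained by fixing the values of some set of coordinates (possibly none, possibly all) and letting the remaining coordinates vary freely. Given a finite family (multiset) of subcubes of $\{0,1\}^d$, in which the same subcube may occur several times, its intersection graph has one vertex for each member of the family, two distinct vertices being adjacent if and only if the corresponding subcubes have non-empty intersection (so two copies of the same subcube are adjacent). $\mathcal{I}(n,d)$ is the set of all graphs on $n$ vertices which can be realised as the intersection graph of a family of $n$ subcubes of $\{0,1\}^d$. $R_d(k,l)$ is the minimum $n$ such that every $G\in\mathcal{I}(n,d)$ contains either a clique $K_k$ on $k$ vertices or an independent set $\overline{K}_l$ of $l$ vertices. *)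

(* Defs.v *)
From mathcomp Require Import all_boot all_order all_algebra.
From mathcomp Require Import boolp reals exp.

Set Implicit Arguments.
Unset Strict Implicit.
Unset Printing Implicit Defensive.

Import Order.TTheory GRing.Theory Num.Theory.

Definition point (d : nat) := {ffun 'I_d -> bool}.

(* Nonempty by construction: it contains the point a that fixes the values. *)
Definition is_subcube (d : nat) (Q : {set point d}) : Prop :=
  exists (S : {set 'I_d}) (a : point d),
    Q = [set x : point d | [forall i in S, x i == a i]].

Record graph (n : nat) := Graph {
  adj :> rel 'I_n;
  adj_sym : symmetric adj;
  adj_irr : irreflexive adj
}.

(* Membership in I(n, d). The family F is indexed and need not be injective,
   so the same subcube may occur several times. *)
Definition subcube_graph (n d : nat) (G : graph n) : Prop :=
  exists F : 'I_n -> {set point d},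
    (forall i, is_subcube (F i)) /\
    (forall i j, G i j = (i != j) && (F i :&: F j != set0)).

Definition has_clique (n : nat) (G : graph n) (k : nat) : Prop :=
  exists S : {set 'I_n},
    #|S| = k /\ forall i j, i \in S -> j \in S -> i != j -> G i j.

Definition has_independent_set (n : nat) (G : graph n) (l : nat) : Prop :=
  exists S : {set 'I_n},
    #|S| = l /\ forall i j, i \in S -> j \in S -> i != j -> ~~ G i j.

Definition ramsey_prop (d k l n : nat) : Prop :=
  forall G : graph n, subcube_graph d G ->
    has_clique G k \/ has_independent_set G l.

(* Some point lies in at least k of any 2 ^ d * k subcubes. *)
Lemma ramsey_prop_ex (d k l : nat) : exists n, `[< ramsey_prop d k l n >].
Proof.
exists (2 ^ d * k); apply/asboolP => G [F [Fcube FG]]; left.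
have /fin_all_exists [p pF] : forall i, exists x, x \in F i.
  move=> i; have [S [a ->]] := Fcube i; exists a.
  by rewrite inE; apply/forall_inP.
have [x kx] : exists x, k <= #|[set i | p i == x]|.
  apply/existsP; rewrite -[X in is_true X]negbK negb_exists.
  apply/negP => /forallP small.
  have card_fibers : \sum_(x : point d) #|[set i | p i == x]| = 2 ^ d * k.
    rewrite -[RHS]card_ord -sum1_card (partition_big p predT) //=.
    by apply: eq_bigr => x _; rewrite -sum1_card; apply: eq_bigl => i; rewrite inE.
  have : \sum_(x : point d) #|[set i | p i == x]|.+1 <= \sum_(x : point d) k.
    by apply: leq_sum => x _; rewrite ltnNge small.
  rewrite sum_nat_const card_ffun card_bool card_ord.
  under eq_bigr do rewrite -addn1.
  rewrite big_split /= card_fibers sum_nat_const card_ffun card_bool card_ord.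
  by rewrite muln1 -[X in _ <= X]addn0 leq_add2l leqn0 expn_eq0.
have /card_geqP[s [s_uniq s_size sF]] := kx.
exists [set i in s]; split; first by rewrite cardsE (card_uniqP s_uniq).
move=> i j; rewrite !inE => /sF; rewrite inE => /eqP pi /sF; rewrite inE.
move=> /eqP pj ij; rewrite FG ij /=; apply/set0Pn; exists x.
by rewrite inE -{1}pi pF -pj pF.
Qed.

Definition ramsey (d k l : nat) : nat := ex_minn (ramsey_prop_ex d k l).

Definition log2 (R : realType) (x : R) : R := (ln x / ln 2)%R.

(* Main.v *)
Require Import Defs.
From mathcomp Require Import all_boot all_order all_algebra.
From mathcomp Require Import boolp reals exp.
From mathcomp Require Import zify ring lra.

Set Implicit Arguments.
Unset Strict Implicit.
Unset Printing Implicit Defensive.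

Import Order.TTheory GRing.Theory Num.Theory.

(** Two subcubes are disjoint exactly when some coordinate is fixed to opposite
values in them, so the complement of an intersection graph of subcubes of the
[d]-cube is a union of [d] complete bipartite graphs, one per coordinate.

Upper bound. In a family with no [k] pairwise intersecting and no [l] pairwise
disjoint members, every coordinate [i] used on both sides splits off two
subfamilies [X_i] and [Y_i]; members of [X_i] are disjoint from members of
[Y_i], so the largest pairwise disjoint subfamilies of [X_i] and [Y_i] have at
most [l - 1] members together. Both subfamilies satisfy the same hypotheses
with a smaller [l] and one coordinate less, and the members outside all of them
meet everything. Induction on [l] bounds the size of the family by
[2 * d ^ (l - 2) * (k - 1)] ([card_le_ramsey_factor]).

Lower bound. Every graph on [d] vertices is the intersection graph of [d]
subcubes of the [d]-cube, since its complement is a union of [d] stars.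
Repeating each cube [m] times keeps the independence number and multiplies the
clique number by [m] ([ramsey_gt_blowup]). It remains to find a graph on [d]
vertices whose complement has no clique of size [l] and no independent set of
size [t], where [t] is of order [d ^ (2 / (l + 1)) * log d]. This is Spencer's
bound for off-diagonal Ramsey numbers: the local lemma ([local_lemma]) applies
to a random graph with edge probability [1 / (N + 1)], with [N] of order
[d ^ (2 / (l + 1))] ([sparse_ramsey_graph]). *)

(** * Families of partial assignments *)

(** A subcube is encoded by the partial assignment of its fixed coordinates:
    [c u i] is [Some b] when the member [u] fixes coordinate [i] to [b]. *)
Definition clash (V C : finType) (c : V -> C -> option bool) (i : C) : rel V :=
  fun u v => [exists b, (c u i == Some b) && (c v i == Some (~~ b))].

(** Two members are separated when the subcubes they encode are disjoint. *)
Definition separated (V C : finType) (c : V -> C -> option bool) : rel V :=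
  fun u v => [exists i, clash c i u v].

(** The relation [e] holds between any two distinct elements of [A]. *)
Definition pairwise_rel (V : finType) (e : rel V) (A : {set V}) : bool :=
  [forall u in A, forall v in A, (u != v) ==> e u v].

Lemma pairwise_relP (V : finType) (e : rel V) (A : {set V}) :
  reflect {in A &, forall u v, u != v -> e u v} (pairwise_rel e A).
Proof.
apply: (iffP forall_inP) => [H u v uA vA uv|H u uA].
  by have /forall_inP/(_ _ vA)/implyP := H _ uA; apply.
by apply/forall_inP => v vA; apply/implyP; exact: H.
Qed.

Lemma clash_sym (V C : finType) (c : V -> C -> option bool) i u v :
  clash c i u v = clash c i v u.
Proof.
by apply/idP/idP => /existsP[b /andP[ub vb]]; apply/existsP; exists (~~ b);
  rewrite negbK vb ub.
Qed.

Lemma separated_sym (V C : finType) (c : V -> C -> option bool) u v :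
  separated c u v = separated c v u.
Proof. by apply: eq_existsb => i; apply: clash_sym. Qed.

Lemma clash_irr (V C : finType) (c : V -> C -> option bool) i u :
  clash c i u u = false.
Proof. by apply/existsP => -[b /andP[/eqP-> /eqP[]]]; case: b. Qed.

Lemma separated_irr (V C : finType) (c : V -> C -> option bool) u :
  separated c u u = false.
Proof. by apply/existsP => -[i]; rewrite clash_irr. Qed.

(** The growth factor of the upper bound. It satisfies the recursion
    [d * (h (d - 1) a + h (d - 1) b) <= h d (a + b + 1)] for [d > 0], which
    fails for plain [2 * d ^ a]. *)
Definition ramsey_factor (d a : nat) : nat :=
  if (d == 0) || (a == 0) then 1 else 2 * d ^ a.

Lemma ramsey_factor_gt0 d a : 0 < ramsey_factor d a.
Proof. by rewrite /ramsey_factor; case: eqP => //=; case: eqP => //= *; nia. Qed.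

Lemma ramsey_factor_mono d e a :
  d <= e -> ramsey_factor d a <= ramsey_factor e a.
Proof.
move=> de; rewrite {1}/ramsey_factor.
case: ifP => [_|]; first exact: ramsey_factor_gt0.
case/norP => d0 a0; rewrite /ramsey_factor (negbTE a0) orbF.
have -> : (e == 0) = false by lia.
by rewrite leq_mul2l leq_exp2r ?lt0n.
Qed.

Lemma ramsey_factor_lt d a : ramsey_factor d a < 2 * d.+1 ^ a.
Proof.
rewrite /ramsey_factor; case: ifP => [_|/norP[_ a0]].
  by have := expn_gt0 d.+1 a; lia.
by rewrite ltn_mul2l /= ltn_exp2r ?lt0n.
Qed.

Lemma ramsey_factor_add d a b j : a + b <= j ->
  ramsey_factor d a + ramsey_factor d b <= 2 * d.+1 ^ j.
Proof.
move=> abj; have := ramsey_factor_lt d a; have := ramsey_factor_lt d b.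
have : d.+1 ^ (a + b) <= d.+1 ^ j by rewrite leq_pexp2l.
have := expn_gt0 d.+1 a; have := expn_gt0 d.+1 b.
rewrite expnD /=; nia.
Qed.

(** All separations within [U] are assumed to happen at coordinates of [D]. The
    proof is by induction on [j]: [D'] is the set of coordinates that take both
    values on [U], [X b i] is the half of [U] with value [b] at [i], and [Z]
    is the set of members of [U] that are separated from none. *)
Lemma card_le_ramsey_factor (V C : finType) (c : V -> C -> option bool) (k j : nat) :
  forall (U : {set V}) (D : {set C}),
    {in U &, forall u v i, clash c i u v -> i \in D} ->
    (forall A : {set V}, A \subset U ->
       pairwise_rel (fun u v => ~~ separated c u v) A -> #|A| <= k) ->
    (forall A : {set V}, A \subset U -> pairwise_rel (separated c) A -> #|A| <= j.+1) ->
  #|U| <= ramsey_factor #|D| j * k.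
Proof.
elim/ltn_ind: j => j IH U D UD Uclique Uindep.
pose X (b : bool) i := [set u in U | c u i == Some b].
pose D' := [set i in D | [forall b, X b i != set0]].
have D'sub : D' \subset D by apply/subsetP => i; rewrite inE => /andP[].
have UD' : {in U &, forall u v i, clash c i u v -> i \in D'}.
  move=> u v uU vU i uv; rewrite inE (UD u v) //=; apply/forallP => b.
  have /existsP[b' /andP[ub vb]] := uv.
  apply/set0Pn; case: (eqVneq b b') => [->|bb].
    by exists u; rewrite inE uU.
  exists v; rewrite inE vU /=; suff -> : b = ~~ b' by [].
  by case: b b' bb {ub vb} => [] [].
apply: leq_trans (_ : ramsey_factor #|D'| j * k <= _); last first.
  by rewrite leq_mul2r ramsey_factor_mono ?orbT ?subset_leq_card.
have [D'0|/set0Pn[i0 i0D']] := eqVneq D' set0.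
  apply: leq_trans (_ : k <= _); last by rewrite leq_pmull ?ramsey_factor_gt0.
  apply: Uclique => //; apply/pairwise_relP => u v uU vU _.
  by apply/existsP => -[i /(UD' _ _ uU vU)]; rewrite D'0 inE.
pose Z := [set u in U | [forall v in U, ~~ separated c u v]].
have ZP u : u \in U -> (forall i b, i \in D' -> u \notin X b i) -> u \in Z.
  move=> uU uX; rewrite inE uU; apply/forall_inP => v vU.
  apply/existsP => -[i uvi]; have iD := UD' _ _ uU vU _ uvi.
  by have /existsP[b /andP[ub _]] := uvi; have := uX _ b iD; rewrite inE uU ub.
(* The largest pairwise separated set in each half of a coordinate. *)
pose al b i :=
  \max_(A : {set V} | (A \subset X b i) && pairwise_rel (separated c) A) #|A|.
have al_le b i (A : {set V}) :
    A \subset X b i -> pairwise_rel (separated c) A -> #|A| <= al b i.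
  by move=> AX Ai; apply: (leq_bigmax_cond (F := fun A : {set V} => #|A|)); rewrite AX.
have al_ex b i : exists A : {set V},
    [/\ A \subset X b i, pairwise_rel (separated c) A & #|A| = al b i].
  have P0 : (set0 \subset X b i) && pairwise_rel (separated c) set0.
    by rewrite sub0set; apply/pairwise_relP => u v; rewrite inE.
  have : 0 < #|[pred A : {set V} |
                 (A \subset X b i) && pairwise_rel (separated c) A]|.
    by apply/card_gt0P; exists set0.
  by case/(eq_bigmax_cond (fun A : {set V} => #|A|)) => A /andP[] *; exists A.
have al_gt0 b i : i \in D' -> 0 < al b i.
  rewrite inE => /andP[_ /forallP/(_ b)/set0Pn[u uX]].
  rewrite -(cards1 u) al_le ?sub1set //.
  by apply/pairwise_relP => v w; rewrite !inE => /eqP-> /eqP->; rewrite eqxx.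
have al_add i : al true i + al false i <= j.+1.
  have [A [AX Ai <-]] := al_ex true i; have [B [BX Bi <-]] := al_ex false i.
  have sepAB u v : u \in A -> v \in B -> separated c u v.
    move=> /(subsetP AX); rewrite inE => /andP[_ ui].
    move=> /(subsetP BX); rewrite inE => /andP[_ vi].
    by apply/existsP; exists i; apply/existsP; exists true; rewrite ui vi.
  have AB0 : A :&: B = set0.
    apply/setP => u; rewrite !inE; apply/negP => /andP[uA uB].
    by have := sepAB _ _ uA uB; rewrite separated_irr.
  rewrite -(cardsUI A B) AB0 cards0 addn0; apply: Uindep.
    rewrite subUset; apply/andP; split.
      by apply/(subset_trans AX)/subsetP => u; rewrite inE => /andP[].
    by apply/(subset_trans BX)/subsetP => u; rewrite inE => /andP[].
  apply/pairwise_relP => u v; rewrite !inE => /orP[uA|uB] /orP[vA|vB] uv.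
  - by move/pairwise_relP: Ai => /(_ u v uA vA uv).
  - exact: sepAB.
  - by rewrite separated_sym sepAB.
  - by move/pairwise_relP: Bi => /(_ u v uB vB uv).
have j_gt0 : 0 < j.
  by have := al_add i0; have := al_gt0 true _ i0D'; have := al_gt0 false _ i0D'; lia.
(* Adding Z to a half changes neither its separations nor its largest
   pairwise separated sets, so Z need not be counted apart. *)
have half b i : i \in D' ->
    #|X b i :|: Z| <= ramsey_factor #|D'|.-1 (al b i).-1 * k.
  move=> iD'; have XZU : X b i :|: Z \subset U.
    by rewrite subUset; apply/andP; split; apply/subsetP => u; rewrite inE => /andP[].
  have noZ u v : u \in U -> v \in U -> separated c u v -> u \notin Z.
    move=> uU vU uv; rewrite inE uU negb_forall; apply/existsP; exists v.
    by rewrite vU uv.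
  have -> : #|D'|.-1 = #|D' :\ i| by rewrite [in LHS](cardsD1 i) iD'.
  apply: IH.
  - have := al_add i; have := al_gt0 true _ iD'; have := al_gt0 false _ iD'.
    by case: b XZU => _; lia.
  - move=> u v uX vX i' uvi.
    have [uU vU] : u \in U /\ v \in U by rewrite !(subsetP XZU).
    have uv : separated c u v by apply/existsP; exists i'.
    rewrite in_setD1 (UD' u v) // andbT; apply/negP => /eqP ii; subst i'.
    move: uX vX; rewrite !in_setU (negbTE (noZ u v _ _ _)) //.
    rewrite (negbTE (noZ v u _ _ _)) // 1?separated_sym //.
    rewrite !orbF !inE uU vU /= => /eqP ub /eqP vb.
    by have /existsP[b' /andP[]] := uvi; rewrite ub vb => /eqP[->] /eqP[]; case: (b').
  - by move=> A AX; apply: Uclique; apply: subset_trans AX XZU.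
  - move=> A AX Ai; rewrite prednK ?al_gt0 //.
    have [A1|A1] := leqP #|A| 1; first exact: leq_trans A1 (al_gt0 _ _ iD').
    apply: al_le => //; apply/subsetP => u uA.
    have [v vA vu] : exists2 v, v \in A & v != u.
      have := cardsD1 u A; rewrite uA => cA.
      have : 0 < #|A :\ u| by lia.
      by case/card_gt0P => v; rewrite !inE => /andP[vu vA]; exists v.
    have := subsetP AX _ uA; rewrite in_setU.
    have AU := subset_trans AX XZU.
    rewrite (negbTE (noZ u v _ _ _)) ?orbF ?(subsetP AU) //.
    by move/pairwise_relP: Ai => /(_ u v uA vA); rewrite eq_sym; apply.
have cover : U \subset \bigcup_(i in D') ((X true i :|: Z) :|: (X false i :|: Z)).
  apply/subsetP => u uU; apply/bigcupP.
  have [/existsP[i /andP[iD' uX]]|] :=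
      boolP [exists i, (i \in D') && [exists b, u \in X b i]].
    exists i => //; case/existsP: uX => -[] uX; rewrite !in_setU uX ?orbT //.
  rewrite negb_exists => /forallP noX; exists i0 => //.
  rewrite !in_setU ZP ?orbT // => i b iD'; apply/negP => uX.
  by have := noX i; rewrite iD' /= negb_exists => /forallP/(_ b); rewrite uX.
apply: leq_trans (subset_leq_card cover) _.
apply: leq_trans (_ : \sum_(i in D') 2 * #|D'| ^ j.-1 * k <= _); last first.
  have D'0 : 0 < #|D'| by apply/card_gt0P; exists i0.
  rewrite sum_nat_const /ramsey_factor.
  have -> : (#|D'| == 0) || (j == 0) = false by lia.
  by rewrite -[in leqRHS](prednK j_gt0) expnS; lia.
elim/big_rec2: _ => [|i S s iD' le]; first by rewrite cards0.
apply: leq_trans (leq_card_setU _ _) _; rewrite leq_add //.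
apply: leq_trans (leq_card_setU _ _) _.
apply: leq_trans (leq_add (half true i iD') (half false i iD')) _.
rewrite -mulnDl leq_mul2r; apply/orP; right.
have D'0 : 0 < #|D'| by apply/card_gt0P; exists i0.
rewrite -{3}(prednK D'0); apply: ramsey_factor_add.
by have := al_add i; have := al_gt0 true _ iD'; have := al_gt0 false _ iD'; lia.
Qed.

(** * Subcubes and the upper bound *)

(** The partial assignment that agrees with [a] on [S]. *)
Definition subcube_assignment d (S : {set 'I_d}) (a : point d) (i : 'I_d) :=
  if i \in S then Some (a i) else None.

Lemma subcubeI_neq0 d (V : finType) (S : V -> {set 'I_d}) (a : V -> point d) u v :
  ([set x : point d | [forall i in S u, x i == a u i]] :&:
   [set x : point d | [forall i in S v, x i == a v i]] != set0) =
  ~~ separated (fun w => subcube_assignment (S w) (a w)) u v.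
Proof.
apply/set0Pn/negP => [[x]|nsep].
  rewrite !inE => /andP[/forall_inP xu /forall_inP xv] /existsP[i /existsP[b]].
  rewrite /subcube_assignment.
  case iSu: (i \in S u) => //; case iSv: (i \in S v); last by rewrite andbF.
  by rewrite -(eqP (xu _ iSu)) -(eqP (xv _ iSv)) => /andP[/eqP[->] /eqP[]]; case: b.
(* Where neither subcube fixes a coordinate, any value would do. *)
exists [ffun i => if i \in S u then a u i else a v i]; rewrite !inE.
apply/andP; split; apply/forall_inP => i iS; rewrite ffunE; first by rewrite iS.
case: ifP => // iSu; apply/negPn/negP => ne; apply: nsep; apply/existsP; exists i.
apply/existsP; exists (a u i); rewrite /subcube_assignment iSu iS eqxx /=.
by apply/eqP; congr Some; case: (a u i) (a v i) ne => [] [].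
Qed.

Lemma ramsey_le d k l n : ramsey_prop d k l n -> ramsey d k l <= n.
Proof. by move=> H; rewrite /ramsey; case: ex_minnP => m _; apply; apply/asboolP. Qed.

Lemma subset_card_eq (T : finType) (A : {set T}) k :
  k <= #|A| -> exists2 B : {set T}, B \subset A & #|B| = k.
Proof.
case/card_geqP => s [us ss sA]; exists [set x in s].
  by apply/subsetP => x; rewrite inE; apply: sA.
by rewrite cardsE (card_uniqP us).
Qed.

Lemma ramsey_upper d k l : 0 < d -> 0 < k -> 2 < l ->
  ramsey d k l < 2 * d ^ (l - 2) * k.
Proof.
move=> d0 k0 l2; set n := 2 * d ^ (l - 2) * k.
have n0 : 0 < n by rewrite !muln_gt0 expn_gt0 d0.
rewrite -(prednK n0) ltnS; apply: ramsey_le => G [F [Fcube FG]].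
have /fin_all_exists [p pF] : forall i, exists p : {set 'I_d} * point d,
    F i = [set x : point d | [forall j in p.1, x j == p.2 j]].
  by move=> i; have [S [a ->]] := Fcube i; exists (S, a).
set c := fun i => subcube_assignment (p i).1 (p i).2.
have Gsep i j : i != j -> G i j = ~~ separated c i j.
  move=> ij; rewrite FG ij /= !pF.
  by rewrite (subcubeI_neq0 (fun w => (p w).1) (fun w => (p w).2)).
case: (pselect (has_clique G k)) => [|noclique]; first by left.
case: (pselect (has_independent_set G l)) => [|noindep]; first by right.
exfalso.
have : #|[set: 'I_n.-1]| <= ramsey_factor #|[set: 'I_d]| (l - 2) * k.-1.
  apply: (@card_le_ramsey_factor _ _ c).
  - by move=> *; rewrite inE.
  - move=> A _ /pairwise_relP Ac; rewrite leqNgt prednK //; apply/negP.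
    case/subset_card_eq => B /subsetP BA cB; apply: noclique; exists B; split=> //.
    by move=> i j /BA iA /BA jA ij; rewrite Gsep // Ac.
  - move=> A _ /pairwise_relP Ac; rewrite leqNgt; apply/negP.
    have -> : (l - 2).+2 = l by lia.
    case/subset_card_eq => B /subsetP BA cB; apply: noindep; exists B; split=> //.
    by move=> i j /BA iA /BA jA ij; rewrite Gsep // negbK Ac.
rewrite !cardsT !card_ord /ramsey_factor.
have -> : (d == 0) || (l - 2 == 0) = false by lia.
have : 0 < d ^ (l - 2) by rewrite expn_gt0 d0.
by rewrite /n; case: (k) k0 => // k' _; set x := d ^ _; nia.
Qed.

(** * The local lemma *)

(** The points that avoid all the events indexed by [J]. *)
Definition avoid (W I : finType) (bad : I -> {set W}) (J : {set I}) : {set W} :=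
  [set w | [forall j in J, w \notin bad j]].

Lemma avoidU1 (W I : finType) (bad : I -> {set W}) (J : {set I}) i :
  avoid bad (i |: J) = avoid bad J :\: bad i.
Proof.
apply/setP => w; rewrite !inE; apply/forall_inP/andP => [H|[wi /forall_inP H] j].
  split; first by rewrite H ?setU11.
  by apply/forall_inP => j jJ; rewrite H // setU1r.
by rewrite in_setU1 => /orP[/eqP->|/H].
Qed.

Lemma avoidS (W I : finType) (bad : I -> {set W}) (J K : {set I}) :
  J \subset K -> avoid bad K \subset avoid bad J.
Proof.
move=> /subsetP JK; apply/subsetP => w; rewrite !inE => /forall_inP H.
by apply/forall_inP => j /JK; apply: H.
Qed.

(** The Lovasz local lemma for the uniform measure on [W], in its lopsided
    form: independence is replaced by an upper bound on the conditional
    probabilities given that events outside of the neighbourhood [nb i] are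
    avoided. *)
Lemma local_lemma (R : realFieldType) (W I : finType) (bad : I -> {set W})
    (nb : I -> {set I}) (x : I -> R) :
  (0 < #|W|)%N -> (forall i, 0 <= x i < 1)%R ->
  (forall i (J : {set I}), [disjoint J & nb i] ->
     #|avoid bad J :&: bad i|%:R <=
       x i * \prod_(j in nb i) (1 - x j) * #|avoid bad J|%:R)%R ->
  exists w, forall i, w \notin bad i.
Proof.
move=> W0 x01 Hbad.
have prod_ge0 (A : {set I}) : (0 <= \prod_(j in A) (1 - x j))%R.
  by apply: prodr_ge0 => j _; have := x01 j; lra.
have step (J : {set I}) i :
    (#|avoid bad J :&: bad i|%:R <= x i * #|avoid bad J|%:R)%R ->
    ((1 - x i) * #|avoid bad J|%:R <= #|avoid bad (i |: J)|%:R :> R)%R.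
  move=> H; rewrite avoidU1.
  have -> : (#|avoid bad J :\: bad i|%:R =
      #|avoid bad J|%:R - #|avoid bad J :&: bad i|%:R :> R)%R.
    by rewrite -[in RHS](cardsID (bad i) (avoid bad J)) natrD; ring.
  lra.
(* The events of [U] are avoided one at a time, on top of those of [J]. *)
have chain n : (forall (S : {set I}) i, #|S| < n ->
      (#|avoid bad S :&: bad i|%:R <= x i * #|avoid bad S|%:R)%R) ->
    forall m (J U : {set I}), #|U| = m -> #|J| + #|U| <= n ->
      (\prod_(j in U) (1 - x j) * #|avoid bad J|%:R
         <= #|avoid bad (U :|: J)|%:R)%R.
  move=> IH; elim=> [|m IHm] J U cU cJ.
    by rewrite (cards0_eq cU) big_set0 set0U mul1r.
  have /card_gt0P[j jU] : 0 < #|U| by rewrite cU.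
  have cUj : #|U| = #|U :\ j|.+1 by rewrite (cardsD1 j) jU.
  rewrite (big_setD1 j) //= -{2}(setD1K jU) -setUA.
  apply: le_trans (step (U :\ j :|: J) j _); last first.
    by apply: IH; apply: leq_ltn_trans (leq_card_setU _ _) _; lia.
  rewrite -mulrA ler_wpM2l //; first by have := x01 j; lra.
  by apply: IHm; lia.
(* Conditioning on avoiding [S], split it into its part [S1] in the
   neighbourhood of [i] and the rest [S2]. *)
have key n : forall (S : {set I}) i, #|S| < n ->
    (#|avoid bad S :&: bad i|%:R <= x i * #|avoid bad S|%:R)%R.
  elim: n => // n IH S i; rewrite ltnS => Sn.
  have /andP[x0 _] := x01 i.
  pose S1 := S :&: nb i; pose S2 := S :\: nb i.
  have S12 : S = S1 :|: S2 by rewrite setID.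
  have dS2 : [disjoint S2 & nb i].
    by rewrite -setI_eq0; apply/eqP/setP => w;
      rewrite !in_setI in_set0 in_setD; case: (w \in nb i); rewrite ?andbF.
  have le1 : (#|avoid bad S :&: bad i|%:R <= #|avoid bad S2 :&: bad i|%:R :> R)%R.
    by rewrite ler_nat subset_leq_card // setSI // avoidS // subsetDl.
  apply: (le_trans le1); apply: (le_trans (Hbad _ _ dS2)).
  rewrite -mulrA ler_wpM2l // [in leRHS]S12.
  have c12 : #|S2| + #|S1| <= n.
    by rewrite addnC; apply: leq_trans Sn; rewrite /S1 /S2 cardsID.
  apply: le_trans (chain n IH #|S1| S2 S1 erefl c12).
  rewrite ler_wpM2r //.
  rewrite (big_setID S) /= -[leRHS]mulr1 setIC.
  apply: ler_wpM2l => //; apply: prodr_ile1 => j _.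
  by have := x01 j; lra.
have := chain #|I|.+1 (key _) #|I| set0 setT (cardsT _).
rewrite cards0 cardsT setU0 => /(_ (leqnSn _)).
have -> : avoid bad set0 = setT.
  by apply/setP => w; rewrite !inE; apply/forall_inP => j; rewrite inE.
rewrite cardsT => le.
have : (0 < #|avoid bad [set: I]|%:R :> R)%R.
  apply: lt_le_trans le; rewrite mulr_gt0 ?ltr0n //.
  by apply: prodr_gt0 => j _; have := x01 j; lra.
rewrite ltr0n => /card_gt0P[w]; rewrite inE => /forall_inP H.
by exists w => i; apply: H; rewrite inE.
Qed.

(** * Independence in a finite product space *)

(** Membership in [A] depends only on the coordinates in [X]. *)
Definition determined_by (E V : finType) (X : {set E}) (A : {set {ffun E -> V}}) :=
  forall w w' : {ffun E -> V}, {in X, w =1 w'} -> (w \in A) = (w' \in A).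

(** Events determined by disjoint sets of coordinates are independent. *)
Lemma card_determinedI (E V : finType) (X Y : {set E}) (A B : {set {ffun E -> V}}) :
  determined_by X A -> determined_by Y B -> [disjoint X & Y] ->
  #|A :&: B| * #|{ffun E -> V}| = #|A| * #|B|.
Proof.
move=> dA dB dXY.
(* Exchanging the coordinates in [X] of two points is an involution that maps
   [(A :&: B) * setT] onto [A * B]. *)
pose sw (p : {ffun E -> V} * {ffun E -> V}) : {ffun E -> V} * {ffun E -> V} :=
  ([ffun e => if e \in X then p.1 e else p.2 e],
   [ffun e => if e \in X then p.2 e else p.1 e]).
have swK : involutive sw.
  move=> [w w']; congr pair; apply/ffunP => e; rewrite !ffunE /=;
    by case eX: (e \in X); rewrite /= ?ffunE ?eX.
rewrite -[#|{ffun E -> V}|]cardsT -!cardsX -(card_imset _ (can_inj swK)).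
have XY e : e \in Y -> (e \in X) = false.
  by move=> eY; apply: contraTF eY => eX; rewrite (disjointFr dXY eX).
apply: eq_card => p; apply/imsetP/idP => [[[w w']]|].
  rewrite !inE /= andbT => /andP[wA wB] ->; rewrite /sw /=; apply/andP; split.
    by rewrite (dA _ w) // => e eX; rewrite ffunE eX.
  by rewrite (dB _ w) // => e eY; rewrite ffunE XY.
case: p => w w'; rewrite !inE /= => /andP[wA wB].
exists (sw (w, w')); last by rewrite swK.
rewrite !inE /= andbT; apply/andP; split.
  by rewrite (dA _ w) // => e eX; rewrite ffunE eX.
by rewrite (dB _ w') // => e eY; rewrite ffunE XY.
Qed.

(** * Elementary inequalities *)

Lemma bin_le_exp n m : 'C(n, m) <= n ^ m.
Proof.
apply: leq_trans (_ : n ^_ m <= _); first by rewrite -bin_ffact leq_pmulr ?fact_gt0.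
elim: m => // m IH; rewrite ffactnSr expnSr leq_mul //; exact: leq_subr.
Qed.

Lemma bernoulli_ge (R : realFieldType) (x : R) n :
  (-1 <= x)%R -> (1 + n%:R * x <= (1 + x) ^+ n)%R.
Proof.
move=> x1; elim: n => [|n IH]; first by rewrite mul0r addr0 expr0.
have n0 : (0 <= n%:R :> R)%R by apply: ler0n.
rewrite exprS; apply: le_trans (_ : (1 + x) * (1 + n%:R * x) <= _)%R.
  by rewrite -natr1; nra.
by apply: ler_wpM2l => //; lra.
Qed.

Lemma bernoulli_sub_ge (R : realFieldType) (x : R) n :
  (x <= 1)%R -> (1 - n%:R * x <= (1 - x) ^+ n)%R.
Proof. by move=> x1; rewrite -mulrN; apply: bernoulli_ge; lra. Qed.

Lemma one_sub_inv_exp_le (R : realFieldType) m :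
  0 < m -> ((1 - m%:R^-1) ^+ m <= 2^-1 :> R)%R.
Proof.
move=> m0; have m1 : (1 <= m%:R :> R)%R by rewrite ler1n.
have i0 : (0 < m%:R^-1 :> R)%R by rewrite invr_gt0; lra.
have i1 : (m%:R^-1 <= 1 :> R)%R by rewrite invf_le1; lra.
(* [(1 - 1/m) * (1 + 1/m) <= 1] and [(1 + 1/m) ^ m >= 2]. *)
have le2 : (2 <= (1 + m%:R^-1) ^+ m :> R)%R.
  apply: le_trans (bernoulli_ge m _); last by lra.
  by rewrite mulfV; lra.
have le1 : ((1 - m%:R^-1) ^+ m * (1 + m%:R^-1) ^+ m <= 1 :> R)%R.
  by rewrite -exprMn; apply: exprn_ile1; nra.
have ge0 : (0 <= (1 - m%:R^-1) ^+ m :> R)%R by apply: exprn_ge0; lra.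
by rewrite -[leRHS]mul1r ler_pdivlMr //; nra.
Qed.

(** * Random graphs *)

(** The pairs of elements of [S], seen as the possible edges within [S]. *)
Definition pairs (T : finType) (S : {set T}) : {set {set T}} :=
  [set e : {set T} | (e \subset S) && (#|e| == 2)].

Lemma card_pairs (T : finType) (S : {set T}) : #|pairs S| = 'C(#|S|, 2).
Proof. exact: cards_draws. Qed.

(** A point [w] of [{ffun {set T} -> 'I_N.+1}] encodes the graph on [T] whose
    edges are the pairs of value [0]; under the uniform measure this is a random
    graph with edge probability [1 / N.+1]. The event [mono_event N b S] says
    that [S] is a clique of it if [b] holds, and independent otherwise. *)
Definition mono_event (T : finType) (N : nat) (b : bool) (S : {set T}) :
    {set {ffun {set T} -> 'I_N.+1}} :=
  [set w : {ffun {set T} -> 'I_N.+1} | [forall e in pairs S, (w e == ord0) == b]].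

Lemma mono_event_determined (T : finType) N b (S : {set T}) :
  determined_by (pairs S) (mono_event N b S).
Proof.
move=> w w' ww'; rewrite !inE; apply/forall_inP/forall_inP => H e eS.
  by rewrite -ww' // H.
by rewrite ww' // H.
Qed.

Lemma card_mono_event (T : finType) N b (S : {set T}) :
  #|mono_event N b S| * N.+1 ^ #|pairs S| =
  (if b then 1 else N) ^ #|pairs S| * #|{ffun {set T} -> 'I_N.+1}|.
Proof.
pose F (e : {set T}) := [pred v : 'I_N.+1 | (e \in pairs S) ==> ((v == ord0) == b)].
have -> : #|mono_event N b S| = \prod_(e : {set T}) #|F e|.
  have -> : #|mono_event N b S| = #|(family F : {pred {ffun {set T} -> 'I_N.+1}})|.
    apply: eq_card => w; rewrite inE; apply/forall_inP/familyP => H e.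
      by rewrite inE; apply/implyP/H.
    by move=> eS; have := H e; rewrite inE eS.
  by rewrite card_family foldrE big_map big_enum.
rewrite (bigID (mem (pairs S))) /=.
have -> : \prod_(e in pairs S) #|F e| = (if b then 1 else N) ^ #|pairs S|.
  rewrite -prod_nat_const; apply: eq_bigr => e eS.
  have [bE|bE] : b = true \/ b = false by clear; case: b; [left|right].
    rewrite bE -(card1 (ord0 : 'I_N.+1)).
    by apply: eq_card => v; rewrite unfold_in /= eS bE eqb_id.
  rewrite bE.
  rewrite -[RHS]/(N.+1.-1) -[N.+1 in RHS]card_ord -(cardC1 (ord0 : 'I_N.+1)).
  by apply: eq_card => v; rewrite unfold_in /= eS bE eqbF_neg inE.
rewrite -mulnA; congr muln.
rewrite card_ffun card_ord -prod_nat_const mulnC -sum1_card.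
have -> : N.+1 ^ (\sum_(e : {set T}) 1) = \prod_(e : {set T}) N.+1.
  by rewrite prod_nat_const sum1_card.
rewrite [RHS](bigID (mem (pairs S))) /=; congr muln.
apply: eq_bigr => e eS.
rewrite -[RHS]card_ord; apply: eq_card => v.
by rewrite unfold_in /= (negbTE eS).
Qed.

(** An [l]-set that contains a given pair is determined by its other [l - 2]
    elements. *)
Lemma card_meeting_pairs (T : finType) (P : {set {set T}}) l : 1 < l ->
  #|[set S : {set T} | (#|S| == l) && ~~ [disjoint P & pairs S]]|
    <= #|P| * #|T| ^ (l - 2).
Proof.
move=> l1.
pose r := [set r : {set T} | (r \subset [set: T]) && (#|r| == l - 2)].
apply: leq_trans (_ : #|[set p.1 :|: p.2 | p in setX P r]| <= _).
  apply/subset_leq_card/subsetP => S; rewrite inE => /andP[/eqP cS].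
  case/pred0Pn => e /= /andP[eP]; rewrite inE => /andP[eS /eqP ce].
  apply/imsetP; exists (e, S :\: e) => /=.
    rewrite in_setX eP /= inE subsetT cardsD (setIidPr eS) cS ce eqxx //.
  by rewrite -{1}(setID S e) (setIidPr eS).
apply: leq_trans (leq_imset_card _ _) _.
by rewrite cardsX cards_draws cardsT leq_mul // bin_le_exp.
Qed.

(** A graph on [T] with no clique of size [l] and no independent set of size
    [t], found by the local lemma. The weights are [x = 4 / N.+1 ^ 'C(l, 2)] for
    the cliques and [y = 1 / (2 * #|T| ^ t)] for the independent sets; two sets
    are neighbours when they share a pair. *)
Lemma sparse_ramsey_graph (T : finType) l t N q :
  2 < l -> 0 < #|T| ->
  8 * 'C(l, 2) * #|T| ^ (l - 2) <= N.+1 ^ ('C(l, 2)).-1 ->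
  #|T| <= 2 ^ q -> 4 * N.+1 * q.+1 < t ->
  exists w : {ffun {set T} -> 'I_N.+1},
    forall b (S : {set T}), #|S| = (if b then l else t) -> w \notin mono_event N b S.
Proof.
move=> l2 T0 hN hq ht; set d := #|T| in T0 hN hq *.
pose E := 'C(l, 2); pose D := d ^ (l - 2).
have E0 : 0 < E by rewrite bin_gt0; lia.
have D0 : 0 < D by rewrite expn_gt0 T0.
have [n nE] : exists n : rat, n = N.+1%:R%R by eexists.
have n1 : (1 <= n)%R by rewrite nE ler1n.
have n0 : (0 < n)%R by lra.
have nE0 : (0 < n ^+ E)%R by apply: exprn_gt0; lra.
have [x xE] : exists x : rat, x = (4 / n ^+ E)%R by eexists.
have [y yE] : exists y : rat, y = (2 * (d ^ t)%:R)^-1%R by eexists.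
have x0 : (0 < x)%R by rewrite xE divr_gt0.
have EDx : (E%:R * D%:R * x <= (2 * n)^-1)%R.
  have hN' : (8 * E%:R * D%:R <= n ^+ E.-1)%R.
    by rewrite -!natrM nE -natrX ler_nat.
  have nE' : (0 < n ^+ E.-1)%R by apply: exprn_gt0; lra.
  have -> : (E%:R * D%:R * x = (8 * E%:R * D%:R) / n ^+ E.-1 * (2 * n)^-1)%R.
    rewrite xE -{2}(prednK E0) exprS; move: (n) (n ^+ _)%R n0 nE' => u v u0 v0.
    by field; rewrite (gt_eqF u0) (gt_eqF v0).
  by rewrite ler_piMl ?invr_ge0 ?ler_pdivrMr ?mul1r //; lra.
have n2 : ((2 * n)^-1 <= 2^-1)%R by rewrite lef_pV2 ?posrE; lra.
have n20 : (0 < (2 * n)^-1)%R by rewrite invr_gt0; lra.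
have E1 : (1 <= E%:R :> rat)%R by rewrite ler1n.
have D1 : (1 <= D%:R :> rat)%R by rewrite ler1n.
have Dx : (D%:R * x <= (2 * n)^-1)%R.
  by apply: le_trans EDx; rewrite -mulrA ler_peMl // mulr_ge0 ?ler0n // ltW.
have x1 : (x <= 2^-1)%R.
  by apply: le_trans (le_trans Dx n2); rewrite ler_peMl // ltW.
have dt1 : (1 <= (d ^ t)%:R :> rat)%R by rewrite ler1n expn_gt0 T0.
have y0 : (0 < y)%R by rewrite yE invr_gt0; lra.
have y1 : (y <= 2^-1)%R by rewrite yE lef_pV2 ?posrE; lra.
pose sz (b : bool) := if b then l else t.
pose bad (i : bool * {set T}) :=
  if #|i.2| == sz i.1 then mono_event N i.1 i.2 else set0.
pose nb (i : bool * {set T}) : {set bool * {set T}} :=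
  [set j : bool * {set T} | (#|j.2| == sz j.1) && ~~ [disjoint pairs i.2 & pairs j.2]].
pose wt (i : bool * {set T}) : rat := if i.1 then x else y.
have prod_nb i : ((1 - x) ^+ (#|pairs i.2| * D) * 2^-1
    <= \prod_(j in nb i) (1 - wt j))%R.
  (* The neighbours that are cliques give the power of [1 - x]; the others
     number at most [d ^ t] and give the factor [1 / 2]. *)
  pose K := [set j : bool * {set T} | j.1].
  rewrite (big_setID K) /=; apply: ler_pM => //.
  - by apply: exprn_ge0; lra.
  - rewrite (eq_bigr (fun=> 1 - x)%R); last first.
      by move=> j; rewrite !inE /wt => /andP[_ ->].
    rewrite prodr_const; apply: ler_wiXn2l; [lra|lra|].
    apply: leq_trans (card_meeting_pairs _ (ltnW l2)).
    apply: leq_trans (leq_imset_card (pair true) _).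
    apply/subset_leq_card/subsetP => -[b S]; rewrite !inE /= => /andP[/andP[cS dS] bt].
    by apply/imsetP; exists S; rewrite ?bt // inE; move: cS; rewrite bt => ->.
  - rewrite (eq_bigr (fun=> 1 - y)%R); last first.
      by move=> j; rewrite !inE /wt => /andP[/negbTE->].
    rewrite prodr_const; apply: le_trans (bernoulli_sub_ge _ _); last by lra.
    have : #|nb i :\: K| <= d ^ t.
      apply: leq_trans (bin_le_exp _ _); rewrite /d -cardsT -cards_draws.
      apply: leq_trans (leq_imset_card (pair false) _).
      apply/subset_leq_card/subsetP => -[b S]; rewrite !inE /=.
      case/andP=> /negbTE-> /andP[cS _].
      by apply/imsetP; exists S; rewrite // inE subsetT.
    rewrite -(ler_nat rat) => le.
    have : ((d ^ t)%:R * y = 2^-1)%R.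
      by rewrite yE invfM mulrCA mulfV ?mulr1; [|apply/eqP; lra].
    have : (#|nb i :\: K|%:R * y <= (d ^ t)%:R * y)%R by rewrite ler_wpM2r // ltW.
    lra.
have prob (i : bool * {set T}) : #|i.2| = sz i.1 ->
    (((if i.1 then 1 else N)%:R / n) ^+ #|pairs i.2|
       <= wt i * ((1 - x) ^+ (#|pairs i.2| * D) * 2^-1))%R.
  case: i => b S /=; rewrite card_pairs => ->; case: b; rewrite /wt /sz /=.
    rewrite -/E expr_div_n expr1n div1r.
    have x_le1 : (x <= 1)%R by lra.
    have le : (2^-1 <= (1 - x) ^+ (E * D))%R.
      apply: le_trans (bernoulli_sub_ge (E * D) x_le1).
      rewrite [(E * D)%:R%R]natrM; have := le_trans EDx n2.
      by move: (_ * x)%R => u; lra.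
    apply: le_trans (_ : x * (2^-1 * 2^-1) <= _)%R.
      rewrite xE; move: (n ^+ E)%R nE0 => u u0.
      have -> : (4 / u * (2^-1 * 2^-1) = u^-1)%R by field; rewrite gt_eqF.
      by rewrite lexx.
    by rewrite ler_pM2l // ler_pM2r.
  set C := 'C(t, 2).
  (* [1 - 1/N.+1 <= z ^ 2]: one factor [z] pays for the neighbouring cliques,
     the other for the weight [y]. *)
  have [z zE] : exists z : rat, z = (1 - (2 * n)^-1)%R by eexists.
  have z0 : (0 <= z)%R by rewrite zE; lra.
  have z1 : (z <= 1)%R by rewrite zE; lra.
  have zD : (z <= (1 - x) ^+ D)%R.
    have x_le1 : (x <= 1)%R by lra.
    by apply: le_trans (bernoulli_sub_ge D x_le1); rewrite zE lerD2l lerN2.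
  have zz : (N%:R / n <= z * z)%R.
    have -> : (N%:R / n = 1 - n^-1)%R.
      by rewrite nE -natr1; field; rewrite natr1 pnatr_eq0.
    have i0 : (0 < n^-1)%R by rewrite invr_gt0; lra.
    by rewrite zE invfM; nra.
  have zC : (z ^+ C <= y * 2^-1)%R.
    have leC : 2 * N.+1 * (q * t + 2) <= C.
      have := bin2 t; rewrite -/C => ->.
      rewrite geq_half_double -muln2.
      have t2 : 1 < t by apply: leq_ltn_trans ht; rewrite !muln_gt0.
      apply: leq_trans (_ : t * (4 * N.+1 * q.+1) <= _); last first.
        by rewrite leq_mul2l -ltnS prednK ?ht ?orbT // ltnW.
      have -> : 2 * N.+1 * (q * t + 2) * 2 = 4 * N.+1 * (q * t + 2).
        by rewrite mulnAC; congr (_ * _); rewrite mulnAC.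
      rewrite mulnCA leq_mul2l; apply/orP; right.
      by rewrite mulnS addnC leq_add // mulnC.
    apply: le_trans (_ : z ^+ (2 * N.+1 * (q * t + 2)) <= _)%R.
      exact: ler_wiXn2l.
    rewrite exprM; apply: le_trans (_ : (2^-1) ^+ (q * t + 2) <= _)%R.
      apply: lerXn2r; rewrite ?nnegrE; [exact: exprn_ge0|by lra|].
      by have := @one_sub_inv_exp_le rat (2 * N.+1) isT; rewrite natrM -nE -zE.
    rewrite exprVn yE -invfM lef_pV2 ?posrE; [|exact: exprn_gt0|by apply: mulr_gt0; lra].
    have : d ^ t <= (2 ^ q) ^ t by rewrite leq_exp2r // (leq_ltn_trans _ ht).
    rewrite -expnM -(ler_nat rat) => le.
    by rewrite exprD -natrX; lra.
  apply: le_trans (_ : z ^+ C * z ^+ C <= _)%R.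
    rewrite -exprMn; apply: lerXn2r; rewrite ?nnegrE ?mulr_ge0 //.
    by rewrite invr_ge0; lra.
  rewrite mulrCA [leRHS]mulrC mulrC; apply: ler_pM; rewrite ?exprn_ge0 //.
  by rewrite mulnC exprM; apply: lerXn2r; rewrite ?nnegrE // exprn_ge0; lra.
have [w Hw] : exists w, forall i, w \notin bad i.
  apply: (@local_lemma rat _ _ bad nb wt).
  - by rewrite card_ffun card_ord expn_gt0.
  - by move=> i; rewrite /wt; case: ifP => _; lra.
  move=> i J dJ; rewrite /bad; case: eqP => [ci|_]; last first.
    rewrite setI0 cards0 mulr_ge0 ?ler0n // mulr_ge0 //.
      by rewrite /wt; case: ifP => _; lra.
    by apply: prodr_ge0 => j _; rewrite /wt; case: ifP => _; lra.
  rewrite -/bad.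
  set A := mono_event _ _ _; set B := avoid bad J.
  have dB : determined_by (~: pairs i.2) B.
    move=> w w' ww'; rewrite !inE.
    apply: eq_forallb_in => j jJ; congr negb; rewrite /bad.
    case: eqP => [cj|]; last by rewrite !inE.
    apply: mono_event_determined => e ej; apply: ww'; rewrite inE; apply/negP => ei.
    have := disjointFr dJ jJ; rewrite inE cj eqxx /= => /negbFE/disjointFr/(_ ei).
    by rewrite ej.
  have dA : determined_by (pairs i.2) A by apply: mono_event_determined.
  have disj : [disjoint pairs i.2 & ~: pairs i.2] by rewrite -setI_eq0 setICr.
  have cAB := card_determinedI dA dB disj.
  have cA := card_mono_event N i.1 i.2; rewrite -/A in cA.
  set W := #|{ffun _ -> _}| in cAB cA.
  have W0 : (0 < W%:R :> rat)%R by rewrite ltr0n /W card_ffun card_ord expn_gt0.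
  set a := (if i.1 then 1 else N) in cA.
  have -> : (#|B :&: A|%:R = (a%:R / n) ^+ #|pairs i.2| * #|B|%:R :> rat)%R.
    have np : (n ^+ #|pairs i.2| != 0)%R by rewrite expf_neq0 //; apply/eqP; lra.
    have W1 : (W%:R != 0 :> rat)%R by rewrite gt_eqF.
    have AE : (#|A|%:R = (a%:R / n) ^+ #|pairs i.2| * W%:R :> rat)%R.
      apply: (mulIf np); rewrite expr_div_n mulrAC mulfVK //.
      by rewrite nE -!natrX -!natrM cA.
    by apply: (mulIf W1); rewrite setIC -natrM cAB natrM AE mulrAC.
  apply: ler_wpM2r; first exact: ler0n.
  apply: le_trans (prob i ci) _; apply: ler_wpM2l; last exact: prod_nb.
  by rewrite /wt; case: ifP => _; lra.
exists w => b S cS; have := Hw (b, S).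
by rewrite /bad /= /sz cS eqxx.
Qed.

(** * The lower bound *)

(** The complement of a graph [e] on [d] vertices is realised by [d] subcubes:
    vertex [v] becomes the cube that fixes coordinate [v] to 1 and the
    coordinates of its neighbours to 0. Repeating each cube [m] times gives
    [d * m] cubes. *)
Lemma ramsey_gt_blowup d k l t m (e : rel 'I_d) :
  symmetric e -> irreflexive e ->
  (forall S : {set 'I_d}, #|S| = l -> ~~ pairwise_rel e S) ->
  (forall S : {set 'I_d}, #|S| = t ->
     ~~ pairwise_rel (fun u v => ~~ e u v) S) ->
  t.-1 * m < k -> d * m < ramsey d k l.
Proof.
move=> esym eirr noclique noindep tmk; rewrite ltnNge; apply/negP.
rewrite /ramsey; case: ex_minnP => n /asboolP Rn _ ndm.
have fP (i : 'I_n) : i %/ m < d.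
  have idm : i < d * m by apply: leq_trans ndm.
  have [m0|m0] := posnP m; first by move: idm; rewrite m0 muln0.
  by rewrite ltn_divLR.
pose f i := Ordinal (fP i).
pose g (i j : 'I_n) := (i != j) && ~~ e (f i) (f j).
have gsym : symmetric g by move=> i j; rewrite /g eq_sym esym.
have girr : irreflexive g by move=> i; rewrite /g eqxx.
pose S v := v |: [set u | e v u].
pose a v : point d := [ffun i => i == v].
have sepE u v : separated (fun w => subcube_assignment (S w) (a w)) u v = e u v.
  apply/existsP/idP => [[i /existsP[b]]|uv].
    rewrite /subcube_assignment.
    case iu: (i \in S u) => //; case iv: (i \in S v); last by rewrite andbF.
    rewrite !ffunE; move: iu iv; rewrite !inE.
    have [->|_] := eqVneq i u; last first.
      have [->|_] := eqVneq i v; first by move=> /= ->.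
      by move=> _ _ /andP[/eqP[<-] /eqP].
    have [->|_ _ /= vu _] := eqVneq u v; last by rewrite esym.
    by move=> _ _ /andP[/eqP[<-] /eqP].
  exists u; apply/existsP; exists true; rewrite /subcube_assignment !inE eqxx /=.
  rewrite !ffunE eqxx /= esym uv orbT /=.
  by have [uv0|//] := eqVneq u v; rewrite uv0 eirr in uv.
have cubeG : subcube_graph d (Graph gsym girr).
  exists (fun i => [set x : point d | [forall j in S (f i), x j == a (f i) j]]).
  split=> [i|i j]; first by exists (S (f i)), (a (f i)).
  by rewrite subcubeI_neq0 /= /g -sepE.
case: (Rn _ cubeG) => -[A [cA HA]].
  have fA : #|f @: A| <= t.-1.
    rewrite leqNgt; apply/negP => tfA.
    have tfA' : t <= #|f @: A| by case: (t) tfA.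
    have [B /subsetP BA cB] := subset_card_eq tfA'.
    have /negP := noindep _ cB; apply; apply/pairwise_relP => u v.
    move=> /BA/imsetP[i iA ->] /BA/imsetP[j jA ->] uv.
    have ij : i != j by apply: contraNneq uv => ->.
    by have := HA _ _ iA jA ij; rewrite /= /g ij.
  have : #|A| <= #|f @: A| * m.
    have [m0|m0] := posnP m.
      case: (set_0Vmem A) => [->|[i _]]; first by rewrite cards0.
      by have := leq_trans (ltn_ord i) ndm; rewrite m0 muln0.
    pose h (i : 'I_n) : 'I_d * 'I_m := (f i, Ordinal (ltn_pmod i m0)).
    have hinj : injective h.
      by move=> i j [di mi]; apply: val_inj; rewrite /= (divn_eq i m) di mi -divn_eq.
    rewrite -(card_imset _ hinj) -[m in leqRHS]card_ord -cardsT -cardsX.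
    apply/subset_leq_card/subsetP => p /imsetP[i iA ->].
    by rewrite !inE andbT /=; apply: imset_f.
  rewrite cA leqNgt => /negP; apply; apply: leq_ltn_trans tmk.
  by rewrite leq_mul2r fA orbT.
have finj : {in A &, injective f}.
  move=> i j iA jA fij; apply/eqP/negPn/negP => ij.
  by have := HA _ _ iA jA ij; rewrite /= /g ij fij eirr.
have cfA : #|f @: A| = l by rewrite card_in_imset.
have /negP := noclique _ cfA; apply; apply/pairwise_relP => u v.
move=> /imsetP[i iA ->] /imsetP[j jA ->] uv.
have ij : i != j by apply: contraNneq uv => ->.
by have := HA _ _ iA jA ij; rewrite /= /g ij /= negbK.
Qed.

(** The random graph of [sparse_ramsey_graph], blown up. *)
Lemma ramsey_gt_local d k l t m N q :
  2 < l -> 0 < d ->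
  8 * 'C(l, 2) * d ^ (l - 2) <= N.+1 ^ ('C(l, 2)).-1 ->
  d <= 2 ^ q -> 4 * N.+1 * q.+1 < t -> t.-1 * m < k -> d * m < ramsey d k l.
Proof.
move=> l2 d0 hN hq ht tmk; have dE := card_ord d.
rewrite -{1 2 3}dE in d0 hN hq.
have [w Hw] := sparse_ramsey_graph l2 d0 hN hq ht.
have pairsE (S : {set 'I_d}) u v : u \in S -> v \in S -> u != v ->
    [set u; v] \in pairs S.
  by move=> uS vS uv; rewrite inE subUset !sub1set uS vS cards2 uv.
pose e := [rel u v | (u != v) && (w [set u; v] == ord0)].
have inpairs (S : {set 'I_d}) p : p \in pairs S ->
    exists u v, [/\ u \in S, v \in S, u != v & p = [set u; v]].
  rewrite inE => /andP[pS /cards2P[u [v [uv pE]]]]; exists u, v.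
  by move: pS; rewrite pE subUset !sub1set => /andP[].
apply: (@ramsey_gt_blowup d k l t m e) => //.
- by move=> u v; rewrite /= eq_sym setUC.
- by move=> u; rewrite /= eqxx.
- move=> S cS; have := Hw true S cS; apply: contra => /pairwise_relP H.
  rewrite inE; apply/forall_inP => p /inpairs[u [v [uS vS uv ->]]].
  by have /andP[_ ->] := H _ _ uS vS uv.
- move=> S cS; have := Hw false S cS; apply: contra => /pairwise_relP H.
  rewrite inE; apply/forall_inP => p /inpairs[u [v [uS vS uv ->]]].
  by have := H _ _ uS vS uv; rewrite /= uv /= => /negbTE->.
Qed.

Lemma double_pred_bin2 l : 2 <= l -> ('C(l, 2)).-1 * 2 = l.+1 * (l - 2).
Proof.
case: l => [|[|l]] // _.
have : 'C(l.+2, 2) * 2 = l.+2 * l.+1.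
  by have := bin_ffact l.+2 2; rewrite -[2`!]/2 !ffactnS ffactn0 muln1 => ->.
by rewrite subn2 /=; nia.
Qed.

(** The choice of [n] of order [d ^ (2 / (l + 1))] makes cliques of size [l]
    rare enough for the local lemma. *)
Lemma edge_density_bound l d n : 2 < l -> 0 < d ->
  (8 * 'C(l, 2) * d) ^ 2 <= n ^ l.+1 ->
  8 * 'C(l, 2) * d ^ (l - 2) <= n ^ ('C(l, 2)).-1.
Proof.
move=> l2 d0 H; set M := 8 * 'C(l, 2) in H *.
have M0 : 0 < M by rewrite muln_gt0 bin_gt0 (ltnW l2).
apply: leq_trans (_ : (M * d) ^ (l - 2) <= _).
  rewrite expnMn leq_mul2r; apply/orP; right.
  by rewrite -{1}(expn1 M) leq_pexp2l // subn_gt0.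
rewrite -(@leq_exp2r _ _ 2) // -!expnM double_pred_bin2 ?(ltnW l2) //.
by rewrite [(l - 2) * 2]mulnC !expnM leq_exp2r // subn_gt0.
Qed.

Theorem theorem16 (R : realType) (l : nat) (hl : (3 <= l)%N) :
  exists c : R, (0 < c)%R /\
    forall d k : nat, (2 <= d)%N -> (1 <= k)%N ->
      (d%:Z * Num.floor (k%:R / (c * (d%:R `^ (2 / (l + 1)%:R)) * log2 (d%:R : R)))
         < (ramsey d k l)%:Z)%R /\
      (ramsey d k l < 2 * d ^ (l - 2) * k)%N.
Proof.
pose M := 8 * 'C(l, 2).
have M0 : 0 < M by rewrite muln_gt0 bin_gt0 (ltnW hl).
have M1 : (1 <= M%:R :> R)%R by rewrite ler1n.
exists (25 * M%:R)%R; split; first by lra.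
move=> d k d2 k0; split; last exact: ramsey_upper (ltnW d2) k0 hl.
pose r : R := (2 / (l + 1)%:R)%R.
have l1 : (0 < (l + 1)%:R :> R)%R by rewrite ltr0n addn1.
have r0 : (0 <= r)%R by rewrite divr_ge0 // ltW.
have r1 : (r <= 1)%R by rewrite ler_pdivrMr // mul1r ler_nat; lia.
have d1 : (1 <= d%:R :> R)%R by rewrite ler1n ltnW.
have [a aE] : exists a : R, a = (d%:R `^ r)%R by eexists.
have a1 : (1 <= a)%R by have := ler_powR d1 r0; rewrite powRr0 -aE.
have [L LE] : exists L : R, L = log2 (d%:R : R) by eexists.
have ln2 : (0 < ln 2 :> R)%R by rewrite ln_gt0 // ltr1n.
have L1 : (1 <= L)%R.
  by rewrite LE /log2 ler_pdivlMr // mul1r ler_ln ?posrE ?ltr0n ?ler_nat // ltnW.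
rewrite -/r -aE -LE.
have [b bE] : exists b : R, b = ((M * d)%:R `^ r)%R by eexists.
have b0 : (0 <= b)%R by rewrite bE powR_ge0.
have ba : (b <= M%:R * a)%R.
  rewrite bE natrM powRM ?ler0n // -aE ler_wpM2r //; first by lra.
  by rewrite -[leRHS]powRr1 ?ler0n // ler_powR.
(* [N.+1] is the least integer above [(M * d) ^ (2 / (l + 1))], and at most
   twice [M * d ^ (2 / (l + 1))]. *)
pose N := Num.truncn b.
have Nb : (N%:R <= b)%R by rewrite truncn_le.
have bN : (b < N.+1%:R)%R by rewrite truncnS_gt.
have hN : (M * d) ^ 2 <= N.+1 ^ l.+1.
  rewrite -(ler_nat R) !natrX; apply: le_trans (_ : b ^+ l.+1 <= _)%R; last first.
    by apply: lerXn2r; rewrite ?nnegrE // ltW.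
  rewrite -(powR_mulrn l.+1 b0) bE -powRrM /r addn1 mulfVK ?powR_mulrn ?ler0n //.
  by rewrite pnatr_eq0.
pose q := up_log 2 d.
have qL : (q.+1%:R <= 3 * L)%R.
  have /andP[lo _] := up_log_bounds (isT : 1 < 2) d2.
  have : ((q.-1)%:R <= L)%R.
    rewrite LE /log2 ler_pdivlMr // mulr_natl -lnXn ?ltr0n //.
    rewrite ler_ln ?posrE ?exprn_gt0 ?ltr0n //; last exact: ltnW.
    by rewrite -natrX ler_nat ltnW.
  have : (q.+1%:R = (q.-1)%:R + 2%:R :> R)%R.
    by rewrite -natrD; congr (_%:R)%R; have := up_log_gt0 2 d; rewrite d2 -/q; lia.
  by move=> ->; lra.
(* [t <= 4 * (2 * M * a) * (3 * L) + 1], whence the constant [25 * M]. *)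
pose t := (4 * N.+1 * q.+1).+1.
have tle : (t%:R <= 25 * M%:R * a * L)%R.
  have Na : (N.+1%:R <= 2 * M%:R * a)%R.
    by rewrite -natr1; nra.
  have : (N.+1%:R * q.+1%:R <= (2 * M%:R * a) * (3 * L))%R.
    by apply: ler_pM; rewrite ?ler0n.
  have : (1 <= M%:R * a * L)%R by rewrite -[leLHS]mulr1 ler_pM ?mulr_ege1 //; nra.
  rewrite /t -natr1 !natrM; lra.
have [m mE] : exists m : nat, Num.floor (k%:R / (25 * M%:R * a * L))%R = m%:Z%R.
  have : (0 <= Num.floor (k%:R / (25 * M%:R * a * L)))%R.
    by rewrite floor_ge0 divr_ge0 ?ler0n // !mulr_ge0 //; lra.
  by case: (Num.floor _) => // m _; exists m.
rewrite mE -PoszM ltz_nat.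
apply: (@ramsey_gt_local d k l t m N q) => //.
- exact: ltnW.
- exact: edge_density_bound (ltnW d2) hN.
- exact: up_logP.
have [m0|m0] := posnP m; first by rewrite m0 muln0.
apply: leq_trans (_ : t * m <= k); first by rewrite ltn_mul2r m0 ltnSn.
have := floor_le (k%:R / (25 * M%:R * a * L))%R; rewrite mE -pmulrn.
rewrite ler_pdivlMr; last by rewrite !mulr_gt0 //; lra.
rewrite -(ler_nat R) natrM => le; apply: le_trans le.
by rewrite mulrC ler_wpM2l ?ler0n.
Qed.
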